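(* Let $\ell\in\frac12\mathbb{N}$ and $\nu>0$, and let $W^{(\nu)}$ be the $(2\ell+1)\times(2\ell+1)$ matrix-valued Gegenbauer weight defined in the context. Then $W^{(\nu)}$ has the LDU-decomposition $$W^{(\nu)}(x)=L^{(\nu)}(x)\,T^{(\nu)}(x)\,L^{(\nu)}(x)^{t},\qquad x\in(-1,1),$$ where $L^{(\nu)}\colon[-1,1]\to M_{2\ell+1}(\mathbb{C})$ is the unipotent lower triangular matrix-valued polynomial with entries $$\bigl(L^{(\nu)}(x)\bigr)_{m,k}=\begin{cases}0 & \text{if } m<k,\\[2pt] \dfrac{m!}{k!\,(2\nu+2k)_{m-k}}\,C^{(\nu+k)}_{m-k}(x) & \text{if } m\ge k,\end{cases}$$ and $T^{(\nu)}\colon(-1,1)\to M_{2\ell+1}(\mathbb{C})$ is the diagonal matrix-valued function with $$\bigl(T^{(\nu)}(x)\bigr)_{k,k}=t^{(\nu)}_k\,(1-x^2)^{k+\nu-1/2},\qquad t^{(\nu)}_k=\frac{k!\,(\nu)_k}{(\nu+1/2)_k}\,\frac{(2\nu+2\ell)_k\,(2\ell+\nu)}{(2\ell-k+1)_k\,(2\nu+k-1)_k},$$ for $m,k\in\{0,1,\dots,2\ell\}$.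
   Context: Matrices are indexed by $\{0,1,\dots,2\ell\}$; $\mathbb{N}=\{0,1,2,\dots\}$; $(a)_0=1$, $(a)_n=a(a+1)\cdots(a+n-1)$ is the Pochhammer symbol; $A^t$ is the transpose. The Gegenbauer polynomials are $C^{(\nu)}_n(x)=\frac{(2\nu)_n}{n!}\,{}_2F_1\!\left(-n,\,n+2\nu;\,\nu+\tfrac12;\,\tfrac12(1-x)\right)$. Definition of the weight. For $\ell\in\frac12\mathbb{N}$, $\nu>0$, $x\in(-1,1)$ and $m,n\in\{0,\dots,2\ell\}$ with $n\ge m$, $$\bigl(W^{(\nu)}(x)\bigr)_{m,n}=(1-x^2)^{\nu-1/2}\sum_{t=\max(0,n+m-2\ell)}^{m}\alpha^{(\nu)}_t(m,n)\,C^{(\nu)}_{m+n-2t}(x),$$ $$\alpha^{(\nu)}_t(m,n)=(-1)^m\frac{n!\,m!\,(m+n-2t)!}{t!\,(2\nu)_{m+n-2t}\,(\nu)_{n+m-t}}\,\frac{(\nu)_{n-t}(\nu)_{m-t}}{(n-t)!\,(m-t)!}\,\frac{n+m-2t+\nu}{n+m-t+\nu}\,(2\ell-m)!\,(n-2\ell)_{m-t}\,(-2\ell-\nu)_t\,\frac{2\ell+\nu}{(2\ell)!},$$ and $W^{(\nu)}(x)$ is extended to a symmetric matrix by $(W^{(\nu)}(x))_{n,m}=(W^{(\nu)}(x))_{m,n}$. *)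

(* Defs.v *)
From HB Require Import structures.
From mathcomp Require Import all_boot all_order all_algebra.
From mathcomp Require Import complex.
From mathcomp Require Import all_classical all_reals all_analysis.

Set Implicit Arguments.
Unset Strict Implicit.
Unset Printing Implicit Defensive.

Import Order.TTheory GRing.Theory Num.Theory.
Import numFieldNormedType.Exports.

Local Open Scope ring_scope.
Local Open Scope complex_scope.

(* The half-integer spin l is encoded by the natural number N = 2l: every
   formula below involves l only through 2l. *)

Section Scalars.
Variable R : realType.
Implicit Types (a b c z nu x : R) (k m n t N : nat).

Definition poch a n : R := \prod_(i < n) (a + i%:R).

(* Full Gauss series, as the limit of its partial sums; for a = -n the terms of
   index > n vanish. *)
Definition hyp2F1 a b c z : R :=
  limn (fun n => \sum_(0 <= k < n)
    poch a k * poch b k / (poch c k * k`!%:R) * z ^+ k).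

Definition gegenbauer nu n x : R :=
  poch (2 * nu) n / n`!%:R
  * hyp2F1 (- n%:R) (n%:R + 2 * nu) (nu + 2^-1) (2^-1 * (1 - x)).

(* Meaningful for (m + n - N) <= t <= m <= n <= N, where no subtraction of
   naturals is truncated. *)
Definition alpha N nu t m n : R :=
  (-1) ^+ m
  * (n`!%:R * m`!%:R * (m + n - 2 * t)`!%:R
     / (t`!%:R * poch (2 * nu) (m + n - 2 * t) * poch nu (n + m - t)))
  * (poch nu (n - t) * poch nu (m - t) / ((n - t)`!%:R * (m - t)`!%:R))
  * (((n + m - 2 * t)%:R + nu) / ((n + m - t)%:R + nu))
  * (N - m)`!%:R
  * poch (n%:R - N%:R) (m - t)
  * poch (- N%:R - nu) t
  * ((N%:R + nu) / N`!%:R).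

(* For m <= n; the truncated (n + m - N)%N is max(0, n + m - N). *)
Definition weight_upper N nu x m n : R :=
  (1 - x ^+ 2) `^ (nu - 2^-1)
  * \sum_(n + m - N <= t < m.+1)
      alpha N nu t m n * gegenbauer nu (m + n - 2 * t) x.

Definition weight_entry N nu x m n : R :=
  if (m <= n)%N then weight_upper N nu x m n else weight_upper N nu x n m.

Definition L_entry nu x m k : R :=
  if (m < k)%N then 0
  else m`!%:R / (k`!%:R * poch (2 * nu + 2 * k%:R) (m - k))
       * gegenbauer (nu + k%:R) (m - k) x.

Definition t_coef N nu k : R :=
  k`!%:R * poch nu k / poch (nu + 2^-1) k
  * (poch (2 * nu + N%:R) k * (N%:R + nu)
     / (poch (N%:R - k%:R + 1) k * poch (2 * nu + k%:R - 1) k)).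

End Scalars.

Section Matrices.
Variables (R : realType) (N : nat) (nu : R).
Implicit Type x : R.

Definition weight x : 'M[R[i]]_(N.+1) :=
  \matrix_(m, n) (weight_entry N nu x m n)%:C.

Definition Lmx x : 'M[R[i]]_(N.+1) :=
  \matrix_(m, k) (L_entry nu x m k)%:C.

Definition Tmx x : 'M[R[i]]_(N.+1) :=
  \matrix_(m, k)
    if m == k
    then (t_coef N nu k * (1 - x ^+ 2) `^ (k%:R + nu - 2^-1))%:C
    else 0.

End Matrices.

Definition unipotent_lower (F : fieldType) n (A : 'M[F]_n) : Prop :=
  is_trig_mx A /\ forall i, A i i = 1.

Definition polynomial_mx_on (R : realType) n (D : set R)
    (A : R -> 'M[R[i]]_n) : Prop :=
  exists P : 'M[{poly R[i]}]_n,
    forall x, D x -> A x = map_mx (fun p : {poly R[i]} => p.[x%:C]) P.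

(* Main.v *)
Require Import Defs.
From HB Require Import structures.
From mathcomp Require Import all_boot all_order all_algebra.
From mathcomp Require Import complex.
From mathcomp Require Import all_classical all_reals all_analysis.
From mathcomp Require Import ring lra zify.

(* Write W_{m,n} for the entries of L diag(t_k (1-x^2)^k) L^t and S_{m,n} for the
   Gegenbauer sums of the weight; both satisfy
     (N-m) W_{m+1,n} + (N-n) W_{m,n+1}
       = 2 (N-m-n) x W_{m,n} + m W_{m-1,n} + n W_{m,n-1},
   which determines row m+1 from rows m and m-1 (no column beyond N is needed,
   because of the factor N-n), and they agree in row 0.  For S the relation
   is checked on the coefficients of each C^(nu)_{m+n+1-2t}, using only the
   three-term recurrence.  For W, the contiguous relations of the Gegenbauer
   polynomials give
     L_{m+1,k} = x L_{m,k} + L_{m,k-1} - rho_k L_{m,k+1},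
     m L_{m-1,k} = m x L_{m,k} + rho_k (2nu+m+k) L_{m,k+1} - (m-k+1) L_{m,k-1},
   while T_k = t_k (1-x^2)^k satisfies
     (N-k) T_{k+1} = rho_k (2nu+N+k) T_k,
   so that the sum over k telescopes. *)

Set Implicit Arguments.
Unset Strict Implicit.
Unset Printing Implicit Defensive.

Import Order.TTheory GRing.Theory Num.Theory.
Import numFieldNormedType.Exports.
Local Open Scope ring_scope.
Local Open Scope classical_set_scope.

(** * Tools for rational identities and for splitting sums *)

Lemma fact_neq0 (R : realType) n : n`!%:R != 0 :> R.
Proof. by rewrite pnatr_eq0 -lt0n fact_gt0. Qed.

Ltac nonzero :=
  rewrite -?andbA; repeat (apply/andP; split);
  try (rewrite ?fact_neq0 //; apply/lt0r_neq0; lra).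

(** Certificate form of elimination: a goal follows from three known equations once explicit
    multipliers are supplied; fewer equations are padded with 0 = 0. *)
Lemma eq_linear_comb (R : comPzRingType) (a b c d e f p q r u v : R) :
  a = b -> c = d -> e = f ->
  u - v = p * (a - b) + q * (c - d) + r * (e - f) -> u = v.
Proof.
move=> -> -> ->; rewrite !subrr !mulr0 !addr0 => /eqP.
by rewrite subr_eq0 => /eqP.
Qed.

Lemma sum_ord_first (V : nmodType) m (F : nat -> V) :
  \sum_(t < m.+1) F t = F 0%N + \sum_(s < m) F s.+1.
Proof. by rewrite big_ord_recl. Qed.

Lemma sum_ord_last (V : nmodType) m (F : nat -> V) :
  \sum_(t < m.+1) F t = \sum_(s < m) F s + F m.
Proof. by rewrite big_ord_recr. Qed.

Lemma sum_ord_ends (V : nmodType) m (F : nat -> V) :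
  \sum_(t < m.+2) F t = F 0%N + \sum_(s < m) F s.+1 + F m.+1.
Proof. by rewrite big_ord_recl big_ord_recr /= addrA. Qed.

(** * Pochhammer symbols *)

Section Pochhammer.
Variable R : realType.
Implicit Types (a : R) (n : nat).

Lemma poch0 a : poch a 0 = 1.
Proof. by rewrite /poch big_ord0. Qed.

Lemma pochSr a n : poch a n.+1 = poch a n * (a + n%:R).
Proof. by rewrite /poch big_ord_recr. Qed.

Lemma pochS a n : poch a n.+1 = a * poch (a + 1) n.
Proof.
rewrite /poch big_ord_recl addr0; congr (_ * _); apply: eq_bigr => i _.
by rewrite -addrA -natr1 [1 + _]addrC.
Qed.

Lemma poch_gt0 a n : 0 < a -> 0 < poch a n.
Proof. by move=> a0; apply: prodr_gt0 => i _; rewrite ltr_wpDr. Qed.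

Lemma poch_neq0 a n : 0 < a -> poch a n != 0.
Proof. by move=> a0; rewrite gt_eqF// poch_gt0. Qed.

Lemma poch_oppn n k : (n < k)%N -> poch (- n%:R : R) k = 0.
Proof.
move=> nk; rewrite /poch (bigD1 (Ordinal nk)) //= addNr mul0r //.
Qed.

(** The entry (m, k) of L is normalised by [poch (2 * (nu + k)) (m - k)]; this compares neighbouring
    columns, where [nu + k] moves by one. *)
Lemma poch2SS a n : poch (2 * a) n.+2 =
  2 * a * (2 * a + 1) * poch (2 * (a + 1)) n :> R.
Proof. by rewrite !pochS mulrA; congr (_ * poch _ _); ring. Qed.

Lemma poch2_shift a n : poch (2 * a) n.+1 * (2 * a + n.+1%:R) =
  2 * a * (2 * a + 1) * poch (2 * (a + 1)) n :> R.
Proof. by rewrite -pochSr poch2SS. Qed.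

End Pochhammer.

(** * Gegenbauer polynomials as terminating hypergeometric sums *)

Section Gegenbauer.
Variable R : realType.
Implicit Types (l x y : R) (n j : nat).

Definition hyp_coef l n j : R :=
  poch (- n%:R) j * poch (n%:R + 2 * l) j / (poch (l + 2^-1) j * j`!%:R).

Definition hyp_sum l n y : R := \sum_(j < n.+1) hyp_coef l n j * y ^+ j.

Lemma hyp_coef_eq0 l n j : (n < j)%N -> hyp_coef l n j = 0.
Proof. by move=> nj; rewrite /hyp_coef poch_oppn// !mul0r. Qed.

(** The factor [poch (- n) j] kills the extra terms, so sums of different degrees can share one
    range. *)
Lemma hyp_sum_widen l n m y : (n <= m)%N ->
  hyp_sum l n y = \sum_(j < m.+1) hyp_coef l n j * y ^+ j.
Proof.
move=> nm; rewrite /hyp_sum (big_ord_widen m.+1 (fun j => hyp_coef l n j * y ^+ j))//.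
rewrite big_mkcond; apply: eq_bigr => j _; case: ltnP => // nj.
by rewrite hyp_coef_eq0 ?mul0r.
Qed.

Lemma hyp2F1E l n y :
  hyp2F1 (- n%:R) (n%:R + 2 * l) (l + 2^-1) y = hyp_sum l n y.
Proof.
(* The partial sums are constant as soon as they have more than n terms. *)
rewrite /hyp2F1; apply/(lim_near_cst (@norm_hausdorff _ _)).
near=> m; rewrite big_mkord.
have nm : (n < m)%N by near: m; exists n.+1.
by rewrite -[m in LHS](ltn_predK nm) -hyp_sum_widen// -ltnS (ltn_predK nm).
Unshelve. all: by end_near.
Qed.

Lemma gegenbauerE l n x :
  gegenbauer l n x = poch (2 * l) n / n`!%:R * hyp_sum l n (2^-1 * (1 - x)).
Proof. by rewrite /gegenbauer hyp2F1E. Qed.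

(** The coefficient of [y ^+ j.+1] in the three-term recurrence, written in y = (1 - x) / 2, so that
    x = 1 - 2y. *)
Lemma hyp_coef_rec l n j : 0 < l ->
  (n.+1%:R + 2 * l) * hyp_coef l n.+2 j.+1 =
  2 * (n.+1%:R + l) * (hyp_coef l n.+1 j.+1 - 2 * hyp_coef l n.+1 j)
  - n.+1%:R * hyp_coef l n j.+1.
Proof.
move=> l0; rewrite /hyp_coef -[n.+2%:R]natr1.
set r : R := n.+1%:R; have -> : n%:R = r - 1 by rewrite /r -natr1 addrK.
have r0 : 0 < r by rewrite ltr0n.
have h0 : l + 2^-1 != 0 by rewrite gt_eqF// addr_gt0.
(* For a positive index every numerator reduces to [poch (1 - r) j] and [poch (r + 2 * l + 1) j]
   times linear factors. *)
case: j => [|j].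
  rewrite !pochS !poch0 fact0 factS fact0; field.
  by apply/lt0r_neq0; lra.
have -> : poch (- (r + 1)) j.+2 = (- r - 1) * (- r) * poch (1 - r) j.
  by rewrite !pochS mulrA; congr (_ * _ * poch _ _); ring.
have -> : poch (- r) j.+2 = (- r) * poch (1 - r) j * (- r + j.+1%:R).
  by rewrite pochSr pochS; congr (_ * poch _ _ * _); ring.
have -> : poch (- r) j.+1 = (- r) * poch (1 - r) j.
  by rewrite pochS; congr (_ * poch _ _); ring.
have -> : poch (- (r - 1)) j.+2 = poch (1 - r) j * (1 - r + j%:R) * (1 - r + j.+1%:R).
  by rewrite !pochSr; congr (poch _ _ * _ * _); ring.
have -> : poch (r + 1 + 2 * l) j.+2 =
    poch (r + 2 * l + 1) j * (r + 1 + 2 * l + j%:R) * (r + 1 + 2 * l + j.+1%:R).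
  by rewrite !pochSr; congr (poch _ _ * _ * _); ring.
have -> : poch (r + 2 * l) j.+2 =
    (r + 2 * l) * poch (r + 2 * l + 1) j * (r + 2 * l + j.+1%:R).
  by rewrite pochSr pochS.
have -> : poch (r + 2 * l) j.+1 = (r + 2 * l) * poch (r + 2 * l + 1) j.
  by rewrite pochS.
have -> : poch (r - 1 + 2 * l) j.+2 =
    (r - 1 + 2 * l) * (r + 2 * l) * poch (r + 2 * l + 1) j.
  by rewrite !pochS mulrA; congr (_ * _ * poch _ _); ring.
rewrite (pochSr (l + 2^-1)) (factS j.+1) natrM.
have hp : poch (l + 2^-1) j.+1 != 0 by rewrite poch_neq0// addr_gt0.
have hf : j.+1`!%:R != 0 :> R by rewrite pnatr_eq0 -lt0n fact_gt0.
have hj : (0 : R) <= j%:R by [].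
rewrite -(natr1 j.+1) -(natr1 j).
field; rewrite hp hf /=; apply/and3P; split=> //; apply/lt0r_neq0; lra.
Qed.

End Gegenbauer.

(** * Three-term recurrence and contiguous relations in the parameter *)

Section GegenbauerRecurrences.
Variable R : realType.
Implicit Types (l x y : R) (n j : nat).

Lemma hyp_sum_rec l n y : 0 < l ->
  (n.+1%:R + 2 * l) * hyp_sum l n.+2 y =
  2 * (n.+1%:R + l) * (1 - 2 * y) * hyp_sum l n.+1 y
  - n.+1%:R * hyp_sum l n y.
Proof.
move=> l0.
(* [A k] is the sum without its constant term 1; the constant terms match because n + 1 + 2l = 2(n +
   1 + l) - (n + 1). *)
pose A k := \sum_(j < n.+2) hyp_coef l k j.+1 * y ^+ j.+1.
have E k : (k <= n.+2)%N -> hyp_sum l k y = 1 + A k.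
  move=> kn; rewrite (@hyp_sum_widen _ _ _ n.+2)// big_ord_recl expr0 mulr1.
  by rewrite /hyp_coef !poch0 fact0 !mulr1 divr1.
have yE : y * hyp_sum l n.+1 y =
    \sum_(j < n.+2) hyp_coef l n.+1 j * y ^+ j.+1.
  by rewrite /hyp_sum mulr_sumr; apply: eq_bigr => j _; rewrite mulrCA exprS.
have AE : (n.+1%:R + 2 * l) * A n.+2 =
    2 * (n.+1%:R + l) * (A n.+1 - 2 * (y * hyp_sum l n.+1 y)) - n.+1%:R * A n.
  rewrite yE /A !(mulr_sumr, =^~ sumrB); apply: eq_bigr => j _.
  by rewrite mulrA hyp_coef_rec//; ring.
rewrite (E n.+2)// mulrDr AE (E n)// 1?ltnW//.
have -> : A n.+1 = hyp_sum l n.+1 y - 1 by rewrite (E n.+1)// addrAC subrr add0r.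
by ring.
Qed.

Lemma gegenbauer0 l x : gegenbauer l 0 x = 1.
Proof.
rewrite gegenbauerE /hyp_sum big_ord1 /hyp_coef !poch0 fact0.
by rewrite expr0 !(divr1, mulr1).
Qed.

Lemma gegenbauer1 l x : 0 < l -> gegenbauer l 1 x = 2 * l * x.
Proof.
move=> l0; rewrite gegenbauerE /hyp_sum big_ord_recl big_ord1 /hyp_coef.
rewrite !pochS !poch0 /= /bump addn0 fact0 (factS 0) fact0 expr0 expr1; field.
by apply/lt0r_neq0; lra.
Qed.

Lemma gegenbauer_rec l n x : 0 < l ->
  n.+2%:R * gegenbauer l n.+2 x =
  2 * (n.+1%:R + l) * x * gegenbauer l n.+1 x
  - (n%:R + 2 * l) * gegenbauer l n x.
Proof.
move=> l0; rewrite !gegenbauerE.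
set y := 2^-1 * (1 - x).
have -> : x = 1 - 2 * y by rewrite /y; field.
have n0 : (0 : R) <= n%:R by [].
have := hyp_sum_rec n y l0.
rewrite !pochSr !factS !natrM -(natr1 n.+1) -(natr1 n).
set a := hyp_sum _ _ _; set b := hyp_sum _ _ _; set c := hyp_sum _ _ _.
have fn : n`!%:R != 0 :> R by rewrite pnatr_eq0 -lt0n fact_gt0.
move: (poch (2 * l) n) => p e.
have -> : a = (2 * (n%:R + 1 + l) * (1 - 2 * y) * b - (n%:R + 1) * c)
              / (n%:R + 1 + 2 * l).
  by rewrite -e mulrAC divff ?mul1r//; apply/lt0r_neq0; lra.
field; rewrite fn /=; apply/and3P; split; apply/lt0r_neq0; lra.
Qed.

Lemma mulX_gegenbauer l n x : 0 < l ->
  2 * x * gegenbauer l n.+1 x =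
  (n.+2%:R * gegenbauer l n.+2 x + (n%:R + 2 * l) * gegenbauer l n x)
  / (n.+1%:R + l).
Proof.
move=> l0; rewrite gegenbauer_rec//; field; apply/lt0r_neq0.
by rewrite ltr_wpDl.
Qed.

(* The right-hand side over n + l satisfies the recurrence of the left one. *)
Lemma gegenbauer_connection l n x : 0 < l ->
  (n.+2%:R + l) * gegenbauer l n.+2 x =
  l * (gegenbauer (l + 1) n.+2 x - gegenbauer (l + 1) n x).
Proof.
move=> l0; have l1 : 0 < l + 1 by lra.
pose a n := gegenbauer l n x; pose b n := gegenbauer (l + 1) n x.
(* Two consecutive cases are carried, since the recurrence has order two. *)
suff : ((n.+2%:R + l) * a n.+2 = l * (b n.+2 - b n)) *
       ((n.+3%:R + l) * a n.+3 = l * (b n.+3 - b n.+1)) by case.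
have rec f k : f \in [:: l; l + 1] -> gegenbauer f k.+2 x =
  (2 * (k%:R + 1 + f) * x * gegenbauer f k.+1 x
   - (k%:R + 2 * f) * gegenbauer f k x) / (k%:R + 2).
  move=> fl; have f0 : 0 < f by move: fl; rewrite !inE => /orP[]/eqP->.
  have := gegenbauer_rec k x f0; rewrite -(natr1 k.+1) -(natr1 k) -addrA.
  by move=> <-; rewrite mulrAC divff ?mul1r.
have la : l \in [:: l; l + 1] by rewrite !inE eqxx.
have lb : l + 1 \in [:: l; l + 1] by rewrite !inE eqxx orbT.
elim: n => [|n [IH1 IH2]].
  rewrite /a /b !(rec _ 1%N)// !(rec _ 0%N)// !gegenbauer0 !gegenbauer1//.
  by split; field.
split=> //.
have n0 : (0 : R) <= n%:R by [].
have e1 : a n.+2 = l * (b n.+2 - b n) / (n%:R + 2 + l).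
  rewrite -IH1 -(natr1 n.+1) -(natr1 n); field; apply/lt0r_neq0; lra.
have e2 : a n.+3 = l * (b n.+3 - b n.+1) / (n%:R + 3 + l).
  rewrite -IH2 -(natr1 n.+2) -(natr1 n.+1) -(natr1 n); field; apply/lt0r_neq0; lra.
rewrite /a (rec _ n.+2)// -!/(a _) e1 e2 /b (rec (l + 1) n.+2)//.
rewrite (rec (l + 1) n.+1)// (rec (l + 1) n)//.
rewrite -(natr1 n.+3) -(natr1 n.+2) -(natr1 n.+1) -(natr1 n).
field; rewrite -?andbA; repeat (apply/andP; split); apply/lt0r_neq0; lra.
Qed.

(** The product with x is expanded by the three-term recurrence at l + 1; [gegenbauer_connection]
    identifies the remaining difference with the left side. *)
Lemma gegenbauer_lowerl l n x : 0 < l ->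
  n.+2%:R * gegenbauer l n.+2 x =
  2 * l * (x * gegenbauer (l + 1) n.+1 x - gegenbauer (l + 1) n x).
Proof.
move=> l0; have l1 : 0 < l + 1 by lra.
have e := mulX_gegenbauer n x l1; have c := gegenbauer_connection n x l0.
have n0 : (0 : R) <= n%:R by [].
have -> : gegenbauer l n.+2 x =
    l * (gegenbauer (l + 1) n.+2 x - gegenbauer (l + 1) n x) / (n.+2%:R + l).
  by rewrite -c mulrAC divff ?mul1r//; apply/lt0r_neq0; rewrite ltr_wpDl.
have -> : 2 * l * (x * gegenbauer (l + 1) n.+1 x - gegenbauer (l + 1) n x) =
    l * (2 * x * gegenbauer (l + 1) n.+1 x - 2 * gegenbauer (l + 1) n x) by ring.
rewrite e -(natr1 n.+1) -(natr1 n); field.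
by apply/lt0r_neq0; lra.
Qed.

(** For n > 0, [gegenbauer_lowerl] trades the product with x for a polynomial of lower degree, and
    [gegenbauer_connection] evaluates the resulting difference. *)
Lemma gegenbauer_raise l n x : 0 < l ->
  (n.+1%:R + 2 * l) * gegenbauer l n.+1 x =
  2 * l * (gegenbauer (l + 1) n.+1 x - x * gegenbauer (l + 1) n x).
Proof.
move=> l0; have l1 : 0 < l + 1 by lra.
case: n => [|n]; first by rewrite gegenbauer0 !gegenbauer1//; ring.
have n0 : (0 : R) <= n%:R by [].
have := gegenbauer_lowerl n x l0; have := gegenbauer_connection n x l0.
have := mulX_gegenbauer n x l1.
rewrite -!(natr1 n.+1) -!(natr1 n) => e c h.
have c' : gegenbauer (l + 1) n.+2 x - gegenbauer (l + 1) n x =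
   (n%:R + 1 + 1 + l) * gegenbauer l n.+2 x / l.
  by rewrite c mulrAC divff ?mul1r//; apply/lt0r_neq0.
have -> : x * gegenbauer (l + 1) n.+1 x =
  gegenbauer (l + 1) n x + (n%:R + 1 + 1) * gegenbauer l n.+2 x / (2 * l).
  by rewrite h; field; apply/lt0r_neq0.
rewrite opprD addrA c'; field; apply/lt0r_neq0; lra.
Qed.

(** After inserting [gegenbauer_raise] and [gegenbauer_lowerl] on the right, the terms of degree n -
    1 at l + 1 cancel and [1 - x ^+ 2] factors out. *)
Lemma gegenbauer_raiser l n x : 0 < l ->
  2 * l * (1 - x ^+ 2) * gegenbauer (l + 1) n x =
  (n%:R + 2 * l) * gegenbauer l n x - n.+1%:R * x * gegenbauer l n.+1 x.
Proof.
move=> l0; have l1 : 0 < l + 1 by lra.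
case: n => [|n]; first by rewrite !gegenbauer0 !gegenbauer1//; ring.
rewrite gegenbauer_raise// [X in _ = _ - X]mulrAC gegenbauer_lowerl//; ring.
Qed.

End GegenbauerRecurrences.

(** * Contiguous relations for the entries of L *)

Section LEntries.
Variables (R : realType) (nu x : R).
Hypothesis nu0 : 0 < nu.
Implicit Types (k m n : nat).

Local Notation L := (L_entry nu x).

Lemma L_entry_lt m k : (m < k)%N -> L m k = 0.
Proof. by rewrite /L_entry => ->. Qed.

Lemma L_entryE k n : L (k + n) k =
  (k + n)`!%:R / (k`!%:R * poch (2 * (nu + k%:R)) n) * gegenbauer (nu + k%:R) n x.
Proof. by rewrite /L_entry ltnNge leq_addr /= addKn mulrDr. Qed.

Lemma L_entry_diag k : L k k = 1.
Proof.
by rewrite -{1}[k]addn0 L_entryE gegenbauer0 poch0 addn0 !mulr1 divff ?fact_neq0.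
Qed.

Lemma L_entry_subdiag k : L k.+1 k = k.+1%:R * x.
Proof.
have k0 : 0 < nu + k%:R by rewrite ltr_pwDl.
rewrite -{1}[k.+1]addn1 L_entryE gegenbauer1// pochS poch0 addn1 factS natrM.
by field; nonzero.
Qed.

(* The entries around (k+n+1, k+1), over a common prefactor, in which the contiguous
   relations between the parameters nu+k and nu+k+1 take place. *)
Lemma L_entry_near k n (l := nu + k%:R) :
  exists c : R,
  [/\ L (k + n.+1) k.+1 = c * gegenbauer (l + 1) n x,
      L (k + n.+1) k = c * (k.+1%:R * (2 * l + n.+1%:R) / (2 * l * (2 * l + 1)))
        * gegenbauer l n.+1 x,
      L (k + n) k = c * (k.+1%:R * (2 * l + n%:R) * (2 * l + n.+1%:R)
          / (2 * l * (2 * l + 1) * (k + n.+1)%:R)) * gegenbauer l n x,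
      L (k + n.+2) k.+1 = c * ((k + n.+2)%:R / (2 * l + n.+2%:R))
        * gegenbauer (l + 1) n.+1 x
    & L (k + n.+2) k = c * (k.+1%:R * (k + n.+2)%:R / (2 * l * (2 * l + 1)))
        * gegenbauer l n.+2 x].
Proof.
have l0 : 0 < l by rewrite ltr_pwDl.
have n0 : (0 : R) <= n%:R by [].
have k0 : (0 : R) <= k%:R by [].
have lS : nu + k.+1%:R = l + 1 by rewrite -natr1 addrA.
pose p := poch (2 * (l + 1)) n.
have p0 : p != 0 by rewrite poch_neq0//; lra.
(* The normalising factor of the entry (k + n + 1, k + 1). *)
exists ((k + n.+1)`!%:R / (k.+1`!%:R * p)).
have pS : poch (2 * l) n.+1 = 2 * l * (2 * l + 1) * p / (2 * l + n.+1%:R).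
  by rewrite /p -poch2_shift -mulrA divff ?mulr1// -natr1; apply/lt0r_neq0; lra.
have pn : poch (2 * l) n = 2 * l * (2 * l + 1) * p
    / (2 * l + n.+1%:R) / (2 * l + n%:R).
  by rewrite -pS pochSr -mulrA divff ?mulr1//; apply/lt0r_neq0; lra.
have fE : (k + n.+2)`! = ((k + n.+2) * (k + n.+1)`!)%N by rewrite addnS factS.
split.
- by rewrite addnS -addSn L_entryE lS.
- rewrite L_entryE pS factS natrM -(natr1 k) -(natr1 n); field; nonzero.
- rewrite L_entryE pn addnS !factS !natrM -(natr1 (k + n)) natrD -(natr1 k) -(natr1 n).
  field; nonzero.
- rewrite addnS -addSn L_entryE lS pochSr -/p addSnnS fE natrM.
  rewrite -(natr1 n.+1) -(natr1 n); field; nonzero.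
- rewrite L_entryE -/l poch2SS -/p fE (factS k) !natrM.
  rewrite -(natr1 k); field; nonzero.
Qed.

(** For m > k this is [gegenbauer_raise] at parameter [nu + k], rescaled; the other rows fall
    outside the range of that relation. *)
Lemma L_entry_raise m k :
  k.+1%:R * (m%:R + k.+1%:R + 2 * nu) * L m.+1 k.+1 =
  m.+1%:R * (k.+1%:R * x * L m k.+1 + (2 * nu + 2 * k%:R + 1) * L m k).
Proof.
case: (ltngtP m k) => [mk|km|<-].
- by rewrite !L_entry_lt// ?ltnS// 1?ltnW// !mulr0 addr0 mulr0.
- have [n ->] : exists n, m = (k + n.+1)%N.
    by exists (m - k).-1; rewrite prednK ?subn_gt0// subnKC// ltnW.
  have l0 : 0 < nu + k%:R by rewrite ltr_pwDl.
  have n0 : (0 : R) <= n%:R by [].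
  have := gegenbauer_raise n x l0.
  rewrite -!(addnS k n.+1); have [c [-> -> _ -> _]] := L_entry_near k n.
  rewrite !addnS -(natr1 (k + n).+1) -(natr1 (k + n)) natrD.
  rewrite -(natr1 k) -(natr1 n.+1) -(natr1 n); set l := nu + k%:R in l0 * => e.
  have -> : gegenbauer l n.+1 x = 2 * l *
      (gegenbauer (l + 1) n.+1 x - x * gegenbauer (l + 1) n x) / (n%:R + 1 + 2 * l).
    by rewrite -e mulrAC divff ?mul1r//; apply/lt0r_neq0; lra.
  have -> : k%:R = l - nu by rewrite addrAC subrr add0r.
  by field; nonzero.
- by rewrite !L_entry_diag L_entry_lt// mulr0 add0r -natr1; ring.
Qed.

Lemma L_entry_lowerl m k :
  k.+1%:R * (2 * nu + k%:R + m.+1%:R) * x * L m.+1 k.+1 =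
  k.+1%:R * m.+1%:R * L m k.+1
  + (m.+1%:R - k%:R) * (2 * nu + 2 * k%:R + 1) * L m.+1 k.
Proof.
case: (ltngtP m k) => [mk|km|<-].
- rewrite !(@L_entry_lt _ k.+1) ?ltnS// 1?ltnW// !mulr0 add0r.
  (* On the edge m + 1 = k the remaining entry is 1, and it is its coefficient that vanishes. *)
  move: mk; rewrite leq_eqVlt => /predU1P[->|mk]; first by rewrite subrr !mul0r.
  by rewrite L_entry_lt// mulr0.
- have [n ->] : exists n, m = (k + n.+1)%N.
    by exists (m - k).-1; rewrite prednK ?subn_gt0// subnKC// ltnW.
  have l0 : 0 < nu + k%:R by rewrite ltr_pwDl.
  have n0 : (0 : R) <= n%:R by [].
  have := gegenbauer_lowerl n x l0.
  rewrite -!(addnS k n.+1); have [c [-> _ _ -> ->]] := L_entry_near k n.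
  rewrite !addnS -(natr1 (k + n).+1) -(natr1 (k + n)) natrD.
  rewrite -(natr1 k) -(natr1 n.+1) -(natr1 n); set l := nu + k%:R in l0 * => e.
  have -> : gegenbauer l n.+2 x = 2 * l *
      (x * gegenbauer (l + 1) n.+1 x - gegenbauer (l + 1) n x) / (n%:R + 1 + 1).
    by rewrite -e mulrAC divff ?mul1r//; apply/lt0r_neq0; lra.
  have -> : k%:R = l - nu by rewrite addrAC subrr add0r.
  by field; nonzero.
- by rewrite !L_entry_diag L_entry_subdiag L_entry_lt// -natr1; ring.
Qed.

(** Rescaled form of [gegenbauer_raiser]; it is the source of the factor [1 - x ^+ 2] in
    [ladder]. *)
Lemma L_entry_raiser m k :
  (1 - x ^+ 2) * k.+1%:R * (2 * nu + m.+1%:R + k%:R) * L m.+1 k.+1 =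
  (2 * nu + 2 * k%:R + 1) *
  (m.+1%:R * L m k - (m.+1%:R - k%:R) * x * L m.+1 k).
Proof.
case: (ltnP m k) => [mk|km].
  rewrite !(@L_entry_lt _ k.+1) ?ltnS// 1?ltnW// (L_entry_lt mk) !mulr0 sub0r.
  move: mk; rewrite leq_eqVlt => /predU1P[->|mk].
    by rewrite subrr !mul0r oppr0 mulr0.
  by rewrite L_entry_lt// mulr0 oppr0 mulr0.
have [n ->] : exists n, m = (k + n)%N by exists (m - k)%N; rewrite subnKC.
have l0 : 0 < nu + k%:R by rewrite ltr_pwDl.
have n0 : (0 : R) <= n%:R by [].
have k0 : (0 : R) <= k%:R by [].
have := gegenbauer_raiser n x l0.
rewrite -!(addnS k n); have [c [-> -> -> _ _]] := L_entry_near k n.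
rewrite addnS -(natr1 (k + n)) natrD.
rewrite -(natr1 k) -(natr1 n); set l := nu + k%:R in l0 * => e.
have e1 : (1 - x ^+ 2) * gegenbauer (l + 1) n x =
    ((n%:R + 2 * l) * gegenbauer l n x - (n%:R + 1) * x * gegenbauer l n.+1 x)
    / (2 * l).
  by rewrite -e; field; apply/lt0r_neq0.
have -> g : (1 - x ^+ 2) * (k%:R + 1) * g * (c * gegenbauer (l + 1) n x) =
    c * (k%:R + 1) * g * ((1 - x ^+ 2) * gegenbauer (l + 1) n x) by ring.
rewrite e1.
have kE : k%:R = l - nu by rewrite addrAC subrr add0r.
have h : 0 <= l - nu by rewrite -kE.
by rewrite kE; field; repeat (apply/andP; split); apply/lt0r_neq0; lra.
Qed.

End LEntries.

(** * Relations between neighbouring rows of L through columns k - 1, k, k + 1 *)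

Section LadderRelations.
Variables (R : realType) (nu x : R).
Hypothesis nu0 : 0 < nu.
Implicit Types (k m n N : nat).

Local Notation L := (L_entry nu x).

(* L_{m,k-1}, read as 0 when k = 0. *)
Definition L_prev m k : R := if k is j.+1 then L m j else 0.

(* rho_k.  The general formula is 0/0 at k = 0, nu = 1/2, hence the separate case. *)
Definition ladder k : R :=
  (1 - x ^+ 2) *
  (if k is j.+1 then (j%:R + 2) * (j%:R + 2 * nu)
     / ((2 * nu + 2 * j%:R + 3) * (2 * nu + 2 * j%:R + 1))
   else (2 * nu + 1)^-1).

Lemma L_entry_col0 m : L m 0 = m`!%:R / poch (2 * nu) m * gegenbauer nu m x.
Proof. by rewrite /L_entry ltn0 /= subn0 fact0 mul1r mulr0 !addr0. Qed.

Lemma L_entry_three_term m : (m.+1%:R + 2 * nu) * L m.+2 0 =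
  2 * (m.+1%:R + nu) * x * L m.+1 0 - m.+1%:R * L m 0.
Proof.
have nu_gt0 := nu0; have m0 : (0 : R) <= m%:R by [].
have := gegenbauer_rec m x nu0; rewrite !L_entry_col0 !pochSr !factS !natrM.
have p0 : poch (2 * nu) m != 0 by rewrite poch_neq0// mulr_gt0.
rewrite -(natr1 m.+1) -(natr1 m) => e.
have -> : gegenbauer nu m.+2 x = (2 * (m%:R + 1 + nu) * x * gegenbauer nu m.+1 x
    - (m%:R + 2 * nu) * gegenbauer nu m x) / (m%:R + 1 + 1).
  by rewrite -e; field; nonzero.
by field; nonzero.
Qed.

(** For m > 0, [L_entry_raiser] brings in column k + 1 and, when k > 0, [L_entry_lowerl] brings in
    column k - 1. *)
Lemma L_entry_pred m k :
  m%:R * L m.-1 k = m%:R * x * L m k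
    + ladder k * (2 * nu + m%:R + k%:R) * L m k.+1
    - (m%:R - k%:R + 1) * L_prev m k.
Proof.
rewrite /L_prev /ladder; case: m => [|m] /=.
  rewrite (@L_entry_lt _ _ _ _ k.+1)// mulr0 addr0 !mul0r add0r.
  case: k => [|[|k]]; first by rewrite mulr0 oppr0.
    (* At m = 0, k = 1 the entry [L_prev] is 1; its coefficient vanishes. *)
    by have -> : 0%:R - 1%:R + 1 = 0 :> R; [ring | rewrite mul0r oppr0].
  by rewrite L_entry_lt// mulr0 oppr0.
have nu_gt0 := nu0; case: k => [|k].
  apply: (eq_linear_comb (p := - (2 * nu + 1)^-1) (q := 0) (r := 0)
    (L_entry_raiser x nu0 m 0) (erefl (0 : R)) (erefl (0 : R))).
  by field; nonzero.
have k0 : (0 : R) <= k%:R by [].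
apply: (eq_linear_comb
  (p := - ((k%:R + 2 * nu) / ((2 * nu + 2 * k%:R + 3) * (2 * nu + 2 * k%:R + 1))))
  (q := - (2 * nu + 2 * k%:R + 1)^-1) (r := 0)
  (L_entry_raiser x nu0 m k.+1) (L_entry_lowerl x nu0 m k) (erefl (0 : R))).
by rewrite -(natr1 k); field; nonzero.
Qed.

(** For m > 0 the [ladder] term comes from [L_entry_raiser], at the price of an entry of row m - 1,
    which is removed by the three-term recurrence in column 0 and by [L_entry_lowerl] in the other
    columns. *)
Lemma L_entry_succ m k :
  L m.+1 k = x * L m k + L_prev m k - ladder k * L m k.+1.
Proof.
have nu_gt0 := nu0; have k0 : (0 : R) <= k%:R by [].
have m0 : (0 : R) <= m%:R by [].
rewrite /L_prev /ladder; case: m m0 => [|m] m0.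
  rewrite (@L_entry_lt _ _ _ _ k.+1)// mulr0 subr0.
  case: k {k0} => [|[|k]].
  - by rewrite L_entry_subdiag// L_entry_diag mulr1 mul1r addr0.
  - by rewrite !L_entry_diag L_entry_lt// mulr0 add0r.
  - by rewrite !L_entry_lt// mulr0 addr0.
have {}m0 : (0 : R) <= m%:R by [].
case: k k0 => [|k] k0.
  apply: (eq_linear_comb (p := ((2 * nu + 1) * (2 * nu + m%:R + 1))^-1)
    (q := (m.+1%:R + 2 * nu)^-1) (r := 0)
    (L_entry_raiser x nu0 m 0) (L_entry_three_term m) (erefl (0 : R))).
  by rewrite -(natr1 m); field; nonzero.
have {}k0 : (0 : R) <= k%:R by [].
(* q scales [L_entry_raiser] so as to produce [ladder]; the third multiplier then cancels the
   entries (m, k + 1). *)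
pose q := (k%:R + 2 * nu) / ((2 * nu + 2 * k%:R + 3) * (2 * nu + 2 * k%:R + 1)
  * (2 * nu + m%:R + k%:R + 2)).
apply: (eq_linear_comb (p := (k.+1%:R * (m%:R + k%:R + 2 + 2 * nu))^-1)
  (q := q) (r := - q * (2 * nu + 2 * k%:R + 3) / k.+1%:R)
  (L_entry_raise x nu0 m.+1 k) (L_entry_raiser x nu0 m k.+1)
  (L_entry_lowerl x nu0 m k)).
by rewrite /q -(natr1 k) -(natr1 m); field; nonzero.
Qed.

End LadderRelations.

(** * The product of L, T and the transpose of L, and its recurrence *)

Section LTLt.
Variables (R : realType) (nu x : R) (N : nat).
Hypothesis nu0 : 0 < nu.
Implicit Types (k m n : nat).

Local Notation L := (L_entry nu x).

(** The scalar power with exponent nu - 1/2, common to both sides of the decomposition, is left out,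
    so that everything is polynomial in x. *)
Definition T_entry k : R := t_coef N nu k * (1 - x ^+ 2) ^+ k.

Definition LTLt m n : R := \sum_(k < N.+1) L m k * T_entry k * L n k.

Lemma T_entry_succ k : (k < N)%N ->
  (N%:R - k%:R) * T_entry k.+1 =
  ladder nu x k * (2 * nu + N%:R + k%:R) * T_entry k.
Proof.
move=> kN; have nu_gt0 := nu0; have k0 : (0 : R) <= k%:R by [].
have Nk : 0 < N%:R - k%:R :> R by rewrite subr_gt0 ltr_nat.
rewrite /T_entry /t_coef /ladder.
have -> : poch (N%:R - k.+1%:R + 1) k.+1 =
    (N%:R - k%:R) * poch (N%:R - k%:R + 1) k :> R.
  by rewrite pochS -natr1; congr (_ * poch _ _); ring.
rewrite exprS (pochSr nu) (pochSr (nu + _)) (pochSr (2 * nu + N%:R)) factS natrM.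
have p1 : poch (N%:R - k%:R + 1) k != 0 :> R by rewrite poch_neq0//; lra.
have p2 : poch (nu + 2^-1) k != 0 by rewrite poch_neq0//; lra.
case: k => [|j] in kN k0 Nk p1 p2 *.
  by rewrite pochS !poch0 /= mulr1n; field; nonzero.
have j0 : (0 : R) <= j%:R by [].
(* Both the base and the length of this symbol move with k; the two consecutive ones overlap in
   [poch (2 * nu + j%:R + 1) j]. *)
have -> : poch (2 * nu + j.+2%:R - 1) j.+2 = poch (2 * nu + j%:R + 1) j
    * (2 * nu + 2 * j%:R + 1) * (2 * nu + 2 * j%:R + 2).
  rewrite !pochSr -(natr1 j.+1) -(natr1 j).
  by congr (_ * _ * _); [congr poch; ring | ring | ring].
have -> : 2 * nu + j.+1%:R - 1 = 2 * nu + j%:R by rewrite -natr1; ring.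
rewrite (pochS (2 * nu + j%:R)).
have p3 : poch (2 * nu + j%:R + 1) j != 0 by rewrite poch_neq0//; lra.
by move: Nk p1; rewrite -(natr1 j) => Nk p1; field; nonzero.
Qed.

Lemma LTLt_rec m n : (m <= N)%N -> (n <= N)%N ->
  (N%:R - m%:R) * LTLt m.+1 n + (N%:R - n%:R) * LTLt m n.+1 =
  2 * (N%:R - m%:R - n%:R) * x * LTLt m n
  + m%:R * LTLt m.-1 n + n%:R * LTLt m n.-1.
Proof.
move=> mN nN; apply/eqP; rewrite -subr_eq0; apply/eqP.
(* [G k] couples columns k - 1 and k, [H k] couples columns k and k + 1; [T_entry_succ] makes
   [G k.+1] equal to [H k] for k < N. *)
pose G k := (N%:R - k%:R + 1) * T_entry k
  * (L_prev nu x m k * L n k + L m k * L_prev nu x n k).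
pose H k := ladder nu x k * (N%:R + 2 * nu + k%:R) * T_entry k
  * (L m k.+1 * L n k + L m k * L n k.+1).
transitivity (\sum_(k < N.+1) (G k - H k)).
  rewrite /LTLt !mulr_sumr -!big_split -sumrB; apply: eq_bigr => k _ /=.
  rewrite !L_entry_succ//.
  apply: (eq_linear_comb (p := - T_entry k * L n k) (q := - T_entry k * L m k)
    (r := 0) (L_entry_pred x nu0 m k) (L_entry_pred x nu0 n k) (erefl (0 : R))).
  by rewrite /G /H; ring.
rewrite sumrB big_ord_recl [X in _ - X]big_ord_recr /=.
(* The boundary terms vanish: nothing precedes column 0, and column N + 1 is zero in rows m, n <=
   N. *)
have -> : G 0%N = 0 by rewrite /G /L_prev mul0r mulr0 addr0 mulr0.
have -> : H N = 0.
  by rewrite /H ![L _ N.+1]L_entry_lt ?ltnS// mul0r mulr0 addr0 mulr0.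
rewrite add0r addr0 -sumrB big1// => k _.
rewrite /G /H /bump /= add1n -natr1 opprD addrA subrK T_entry_succ//.
by rewrite [N%:R + _]addrC; ring.
Qed.

End LTLt.

(** * Recurrences for the coefficients alpha *)

Section GegenbauerExpansion.
Variables (R : realType) (nu : R).
Hypothesis nu0 : 0 < nu.
Implicit Types (i j k m n p s t N : nat).

(* alpha at m = i+t, n = j+t, without its factor (n-2l)_i. *)
Definition alpha_weight N i j t : R :=
  (-1) ^+ (i + t)
  * ((j + t)`!%:R * (i + t)`!%:R * (i + j)`!%:R
     / (t`!%:R * poch (2 * nu) (i + j) * poch nu (i + j + t)))
  * (poch nu j * poch nu i / (j`!%:R * i`!%:R))
  * (((i + j)%:R + nu) / ((i + j + t)%:R + nu))
  * (N - (i + t))`!%:R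
  * poch (- N%:R - nu) t
  * ((N%:R + nu) / N`!%:R).

Lemma alphaE N i j t :
  alpha N nu t (i + t) (j + t) =
  alpha_weight N i j t * poch ((j + t)%:R - N%:R) i.
Proof.
rewrite /alpha /alpha_weight.
have -> : (i + t + (j + t) - 2 * t = i + j)%N by lia.
have -> : (j + t + (i + t) - 2 * t = i + j)%N by lia.
have -> : (j + t + (i + t) - t = i + j + t)%N by lia.
by rewrite !addnK; ring.
Qed.

(** The factor N - n brings the base n + 1 - N back to n - N at the cost of one more factor, so
    terms with n + 1 become comparable to terms with n. *)
Lemma mulr_poch_succ N n i (w : R) :
  (N%:R - n%:R) * (w * poch (n.+1%:R - N%:R) i) =
  - (w * (poch (n%:R - N%:R) i * (n%:R - N%:R + i%:R))).
Proof. by rewrite -pochSr pochS -natr1 addrAC; ring. Qed.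

(* Coefficients of C_{m+n+1-2t} for t = 0, for t = s+1 <= m and for t = m+1. *)
Lemma alpha_rec_first N i j : (i < N)%N ->
  (N%:R - i%:R) * alpha N nu 0 i.+1 j + (N%:R - j%:R) * alpha N nu 0 i j.+1 =
  (N%:R - i%:R - j%:R) * (alpha N nu 0 i j * ((i + j).+1%:R / ((i + j)%:R + nu))).
Proof.
move=> iN; have nu_gt0 := nu0; have i0 : (0 : R) <= i%:R by [].
have j0 : (0 : R) <= j%:R by [].
have E a b : alpha N nu 0 a b = alpha_weight N a b 0 * poch (b%:R - N%:R) a.
  by rewrite -{1}[a]addn0 -{1}[b]addn0 alphaE addn0.
rewrite !E mulr_poch_succ pochSr /alpha_weight !addn0 addSn addnS.
have -> : (N - i = (N - i.+1).+1)%N by lia.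
have NE : N%:R = i%:R + 1 + (N - i.+1)%:R :> R.
  by rewrite natr1 -natrD subnKC.
rewrite exprS !factS !natrM !pochSr.
have p1 : poch (2 * nu) (i + j) != 0 by rewrite poch_neq0// mulr_gt0.
have p2 : poch nu (i + j) != 0 by rewrite poch_neq0.
rewrite -(natr1 (i + j)) -(natr1 (N - i.+1)) -(natr1 i) -(natr1 j) natrD.
have := fact_neq0 R N; move: (N`!%:R : R) => f f0; rewrite NE.
have : (0 : R) <= (N - i.+1)%:R by [].
move: ((N - i.+1)%:R : R) => q q0.
by field; nonzero.
Qed.

(* K collects everything but the factors, linear in the parameters, by which the
   terms of the middle case of the recurrence differ. *)
Lemma alpha_weight_near N i j s p : N = ((i + s).+2 + p)%N ->
  exists K : R,
  [/\ p.+1%:R * alpha_weight N i.+1 j s.+1 =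
        K * ((i + s).+2%:R * (i%:R + nu) * ((i + j).+1%:R + nu)
             * (- N%:R - nu + s%:R) * j.+1%:R),
      alpha_weight N i j.+1 s.+1 =
        - K * ((j + s).+2%:R * (j%:R + nu) * ((i + j).+1%:R + nu)
             * (- N%:R - nu + s%:R) * i.+1%:R),
      alpha_weight N i j s.+1 * ((i + j).+1%:R / ((i + j)%:R + nu)) =
        - K * ((- N%:R - nu + s%:R) * ((i + j)%:R + 2 * nu) * i.+1%:R * j.+1%:R
             * ((i + j + s).+2%:R + nu)),
      alpha_weight N i.+1 j.+1 s
          * (((i + j).+1%:R + 2 * nu) / ((i + j).+2%:R + nu)) =
        - K * ((i + j).+2%:R * (i%:R + nu) * (j%:R + nu) * s.+1%:R)
    & (i + s).+1%:R * alpha_weight N i j.+1 s =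
        K * ((j%:R + nu) * ((i + j).+1%:R + nu) * p.+2%:R * i.+1%:R * s.+1%:R
             * ((i + j + s).+2%:R + nu)) /\
      (j + s).+1%:R * alpha_weight N i.+1 j s =
        - K * ((i%:R + nu) * ((i + j).+1%:R + nu) * j.+1%:R * s.+1%:R
             * ((i + j + s).+2%:R + nu))].
Proof.
(* This is [alpha_weight N i j s] with p! for (N - i - s)! and without its quotient (i + j + nu) /
   (i + j + s + nu), times a quotient that leaves only products of linear factors in the six
   equations. *)
move=> NE; exists ((-1) ^+ (i + s)
  * ((j + s)`!%:R * (i + s)`!%:R * (i + j)`!%:R
     / (s`!%:R * poch (2 * nu) (i + j) * poch nu (i + j + s)))
  * (poch nu j * poch nu i / (j`!%:R * i`!%:R)) * p`!%:R
  * poch (- N%:R - nu) s * ((N%:R + nu) / N`!%:R)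
  * ((j + s).+1%:R * (i + s).+1%:R * p.+1%:R * (i + j).+1%:R
     / (((i + j)%:R + 2 * nu) * ((i + j + s)%:R + nu) * ((i + j + s).+1%:R + nu)
        * s.+1%:R * i.+1%:R * j.+1%:R * ((i + j + s).+2%:R + nu)))).
rewrite /alpha_weight !(addSn, addnS).
have -> : (N - (i + s) = p.+2)%N by lia.
have -> : (N - (i + s).+1 = p.+1)%N by lia.
have -> : (N - (i + s).+2 = p)%N by lia.
rewrite {NE} !exprS !factS !natrM !pochSr !(addrC nu) !(addrC (2 * nu)).
have nz k : k%:R + nu != 0 by rewrite gt_eqF// ltr_wpDl.
have nz2 k : k%:R + 2 * nu != 0 by rewrite gt_eqF// ltr_wpDl// mulr_gt0.
have nS k : k.+1%:R != 0 :> R by rewrite pnatr_eq0.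
(* All symbols and linear factors become independent variables: the six equations are identities
   between quotients of monomials. *)
move: (poch (2 * nu) (i + j)) (poch_neq0 (i + j) (mulr_gt0 (ltr0n R 2) nu0)) => P P0.
move: (poch nu (i + j + s)) (poch_neq0 (i + j + s) nu0) => P' P'0.
move: (poch nu i) (poch nu j) (poch _ s) => Pi Pj Ps.
move: (N`!%:R : R) (fact_neq0 R N) (s`!%:R : R) (fact_neq0 R s) => fN fN0 fs fs0.
move: (i`!%:R : R) (fact_neq0 R i) (j`!%:R : R) (fact_neq0 R j) => fi fi0 fj fj0.
move: (p`!%:R : R) ((j + s)`!%:R : R) ((i + s)`!%:R : R) ((i + j)`!%:R : R).
move=> fp fjs fis fij.
move: ((-1) ^+ (i + s)) => sg.
move: (N%:R + nu) (- N%:R - nu + s%:R) => N1 N2.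
move: ((i + j + s)%:R + nu) (nz (i + j + s)%N) => d0 d00.
move: ((i + j + s).+1%:R + nu) (nz (i + j + s).+1) => d1 d10.
move: ((i + j + s).+2%:R + nu) (nz (i + j + s).+2) => d2 d20.
move: ((i + j)%:R + nu) (nz (i + j)%N) => e0 e00.
move: ((i + j).+1%:R + nu) ((i + j).+2%:R + nu) (nz (i + j).+2) => e1 e2 e20.
move: ((i + j)%:R + 2 * nu) (nz2 (i + j)%N) => g0 g00.
move: ((i + j).+1%:R + 2 * nu) (nz2 (i + j).+1) => g1 g10.
move: (i%:R + nu) (j%:R + nu) => i0 j0.
move: (i.+1%:R : R) (nS i) (j.+1%:R : R) (nS j) (s.+1%:R : R) (nS s).
move=> i1 i10 j1 j10 s1 s10.
move: ((j + s).+2%:R : R) ((i + s).+2%:R : R) ((j + s).+1%:R : R) => js2 is2 js1.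
move: ((i + s).+1%:R : R) ((i + j).+2%:R : R) ((i + j).+1%:R : R) => is1 ij2 ij1.
move: (p.+2%:R : R) (p.+1%:R : R) => p2 p1.
by by split; [| | | | split]; field; rewrite -?andbA; repeat (apply/andP; split).
Qed.

Lemma alpha_rec_mid N i j s (m := (i + s.+1)%N) (n := (j + s.+1)%N) :
  (m < N)%N ->
  (N%:R - m%:R) * alpha N nu s.+1 m.+1 n + (N%:R - n%:R) * alpha N nu s.+1 m n.+1 =
  (N%:R - m%:R - n%:R) *
    (alpha N nu s.+1 m n * ((i + j).+1%:R / ((i + j)%:R + nu))
     + alpha N nu s m n * (((i + j).+1%:R + 2 * nu) / ((i + j).+2%:R + nu)))
  + m%:R * alpha N nu s m.-1 n + n%:R * alpha N nu s m n.-1.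
Proof.
move=> mN.
(* Lowering t from s + 1 to s at fixed m and n raises both offsets m - t and n - t by one. *)
rewrite (_ : alpha N nu s m n = alpha N nu s (i.+1 + s) (j.+1 + s)); last first.
  by rewrite !addSnnS.
rewrite (_ : alpha N nu s m.-1 n = alpha N nu s (i + s) (j.+1 + s)); last first.
  by rewrite !addSnnS /m addnS.
rewrite (_ : alpha N nu s m n.-1 = alpha N nu s (i.+1 + s) (j + s)); last first.
  by rewrite !addSnnS /n addnS.
rewrite -[m.+1]/(i.+1 + s.+1)%N -[n.+1]/(j.+1 + s.+1)%N !alphaE.
have -> : (j.+1 + s = n)%N by rewrite addSnnS.
rewrite addSn -/n mulr_poch_succ; set q : R := n%:R - N%:R.
(* With q = n - N, every Pochhammer symbol whose base depends on n is [poch q i] times linear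
   factors. *)
have -> : poch ((j + s)%:R - N%:R) i.+1 = (q - 1) * poch q i.
  rewrite pochS /q /n addnS -natr1.
  by congr (_ * poch _ _); ring.
rewrite (pochSr q i).
have [p NE] : exists p, N = ((i + s).+2 + p)%N.
  by exists (N - (i + s).+2)%N; rewrite subnKC// -addnS.
have [K [X Y U V [M Z]]] := alpha_weight_near j NE.
have mE : N%:R - m%:R = p.+1%:R :> R.
  by rewrite -natrB ?(ltnW mN)//; congr _%:R; rewrite /m; lia.
transitivity ((p.+1%:R * alpha_weight N i.+1 j s.+1)
    * (poch q i * (q + i%:R))
  - alpha_weight N i j.+1 s.+1 * (poch q i * (q + i%:R))).
  by rewrite mE; ring.
rewrite X Y.
transitivity ((N%:R - m%:R - n%:R) *
  (alpha_weight N i j s.+1 * ((i + j).+1%:R / ((i + j)%:R + nu)) * poch q i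
   + alpha_weight N i.+1 j.+1 s * (((i + j).+1%:R + 2 * nu) / ((i + j).+2%:R + nu))
     * (poch q i * (q + i%:R)))
  + (i + s).+1%:R * alpha_weight N i j.+1 s * poch q i
  + (j + s).+1%:R * alpha_weight N i.+1 j s * ((q - 1) * poch q i)); last first.
  by rewrite /m /n !addnS; ring.
(* With K and Q as common factors, a polynomial identity in i, j, s, p and nu remains. *)
rewrite U V M Z; move: (poch q i) => Q; rewrite /q /m /n NE; ring.
Qed.

Lemma alpha_rec_last N j s (n := (j + s.+1)%N) : (s < N)%N ->
  (N%:R - s%:R) * alpha N nu s.+1 s.+1 n =
  (N%:R - s%:R - n%:R) *
    (alpha N nu s s n * ((j%:R + 2 * nu) / (j.+1%:R + nu)))
  + n%:R * alpha N nu s s n.-1.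
Proof.
move=> sN; have nu_gt0 := nu0.
have j0 : (0 : R) <= j%:R by []; have s0 : (0 : R) <= s%:R by [].
(* Here m = t, so the Pochhammer symbol of length m - t is empty. *)
have E t k : alpha N nu t t (k + t) = alpha_weight N 0 k t.
  by rewrite -{2}[t]add0n alphaE poch0 mulr1.
rewrite (E s.+1 j : alpha N nu s.+1 s.+1 n = _).
have -> : alpha N nu s s n = alpha_weight N 0 j.+1 s by rewrite -E addSnnS.
have -> : alpha N nu s s n.-1 = alpha_weight N 0 j s by rewrite -E /n addnS.
rewrite /n.
rewrite /alpha_weight !add0n !(addSn, addnS).
have -> : (N - s = (N - s.+1).+1)%N by lia.
have NE : N%:R = s%:R + 1 + (N - s.+1)%:R :> R.
  by rewrite natr1 -natrD subnKC.
rewrite !exprS !factS !natrM !pochSr.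
have p0 : poch nu j != 0 by rewrite poch_neq0.
have p1 : poch (2 * nu) j != 0 by rewrite poch_neq0// mulr_gt0.
have p2 : poch nu (j + s) != 0 by rewrite poch_neq0.
have := fact_neq0 R N; move: (N`!%:R : R) => f f0.
have : (0 : R) <= (N - s.+1)%:R by [].
rewrite -!(natr1 (N - s.+1)) NE.
move: ((N - s.+1)%:R : R) ((N - s.+1)`!%:R : R) => q g q0.
rewrite -!(natr1 (j + s)) -!(natr1 j) -!(natr1 s) !natrD.
move: (poch _ s) => B.
move: (poch nu (j + s)) p2 (poch (2 * nu) j) p1 => P p2 P' p1.
have := fact_neq0 R j; have := fact_neq0 R s.
move: (j`!%:R : R) (s`!%:R : R) => fj fs fs0 fj0.
by field; nonzero.
Qed.

End GegenbauerExpansion.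

(** * Recurrence for the Gegenbauer sums of the weight *)

Section GegenbauerSum.
Variables (R : realType) (nu x : R) (N : nat).
Hypothesis nu0 : 0 < nu.
Implicit Types (i j k m n s t : nat).

(** Starting at t = 0 for every N keeps the ranges uniform in the recurrence; by [alpha_eq0] the
    extra terms vanish when m <= n <= N. *)
Definition gegenbauer_sum m n : R :=
  \sum_(t < m.+1) alpha N nu t m n * gegenbauer nu (m + n - 2 * t) x.

(** Since m < n, the index m + n - 2t is positive for t <= m, so [mulX_gegenbauer] expands every
    term of the product with x. *)
Lemma gegenbauer_sum_rec m n : (m < n)%N -> (m < N)%N ->
  (N%:R - m%:R) * gegenbauer_sum m.+1 n + (N%:R - n%:R) * gegenbauer_sum m n.+1 =
  2 * (N%:R - m%:R - n%:R) * x * gegenbauer_sum m n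
  + m%:R * gegenbauer_sum m.-1 n + n%:R * gegenbauer_sum m n.-1.
Proof.
move=> mn mN.
(* With p = m + n - 2t, [D t] has degree p + 1, [D t.+1] has degree p - 1, and 2x times the
   polynomial of degree p is [u t * D t + v t * D t.+1]. *)
pose D t := gegenbauer nu ((m + n).+1 - 2 * t) x.
pose u t : R := (m + n - 2 * t).+1%:R / ((m + n - 2 * t)%:R + nu).
pose v t : R := ((m + n - 2 * t).-1%:R + 2 * nu) / ((m + n - 2 * t)%:R + nu).
have -> : gegenbauer_sum m.+1 n = \sum_(t < m.+2) alpha N nu t m.+1 n * D t by [].
have -> : gegenbauer_sum m n.+1 = \sum_(t < m.+1) alpha N nu t m n.+1 * D t.
  by rewrite /gegenbauer_sum addnS.
have -> : gegenbauer_sum m n.-1 = \sum_(t < m.+1) alpha N nu t m n.-1 * D t.+1.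
  apply: eq_bigr => t _; rewrite /D; congr (_ * gegenbauer _ _ _); lia.
have -> : m%:R * gegenbauer_sum m.-1 n =
    m%:R * \sum_(t < m) alpha N nu t m.-1 n * D t.+1.
  (* For m = 0 the two sums differ, because the predecessor is truncated; the factor m hides
     this. *)
  rewrite /gegenbauer_sum /D; case: (m) => [|k]; first by rewrite !mul0r.
  congr (_ * _); apply: eq_bigr => t _; congr (_ * gegenbauer _ _ _).
  by rewrite /=; lia.
have -> : 2 * (N%:R - m%:R - n%:R) * x * gegenbauer_sum m n =
    (N%:R - m%:R - n%:R) * (\sum_(t < m.+1) alpha N nu t m n * u t * D t
      + \sum_(t < m.+1) alpha N nu t m n * v t * D t.+1).
  transitivity ((N%:R - m%:R - n%:R) * (2 * x * gegenbauer_sum m n)); first by ring.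
  congr (_ * _); rewrite /gegenbauer_sum -big_split mulr_sumr; apply: eq_bigr => t _ /=.
  have tm := ltn_ord t; rewrite /D /u /v.
  have -> : ((m + n).+1 - 2 * t = (m + n - 2 * t).-1.+2)%N by lia.
  have -> : ((m + n).+1 - 2 * t.+1 = (m + n - 2 * t).-1)%N by lia.
  have -> : (m + n - 2 * t = (m + n - 2 * t).-1.+1)%N by lia.
  move: (_.-1) => q.
  transitivity (alpha N nu t m n * (2 * x * gegenbauer nu q.+1 x)); first by ring.
  by rewrite mulX_gegenbauer//=; ring.
(* All sums are aligned on [D s.+1] with s < m, leaving [D 0] and [D m.+1] apart. *)
rewrite (sum_ord_ends m (fun t => alpha N nu t m.+1 n * D t)).
rewrite (sum_ord_first m (fun t => alpha N nu t m n.+1 * D t)).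
rewrite (sum_ord_first m (fun t => alpha N nu t m n * u t * D t)).
rewrite (sum_ord_last m (fun t => alpha N nu t m n * v t * D t.+1)).
rewrite (sum_ord_last m (fun t => alpha N nu t m n.-1 * D t.+1)).
have mid : (N%:R - m%:R) * (\sum_(s < m) alpha N nu s.+1 m.+1 n * D s.+1)
    + (N%:R - n%:R) * (\sum_(s < m) alpha N nu s.+1 m n.+1 * D s.+1) =
    (N%:R - m%:R - n%:R) * (\sum_(s < m) alpha N nu s.+1 m n * u s.+1 * D s.+1
      + \sum_(s < m) alpha N nu s m n * v s * D s.+1)
    + m%:R * (\sum_(s < m) alpha N nu s m.-1 n * D s.+1)
    + n%:R * (\sum_(s < m) alpha N nu s m n.-1 * D s.+1).
  rewrite -big_split !mulr_sumr -!big_split /=; apply: eq_bigr => s _.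
  have sm := ltn_ord s.
  have em : m = (m - s.+1 + s.+1)%N by lia.
  have en : n = (n - s.+1 + s.+1)%N by lia.
  have := @alpha_rec_mid _ _ nu0 N (m - s.+1) (n - s.+1) s; rewrite -em -en.
  move=> /(_ mN) e; rewrite /u /v.
  have -> : (m + n - 2 * s.+1 = m - s.+1 + (n - s.+1))%N by lia.
  have -> : (m + n - 2 * s = (m - s.+1 + (n - s.+1)).+2)%N by lia.
  apply: (eq_linear_comb (p := D s.+1) (q := 0) (r := 0)
    e (erefl (0 : R)) (erefl (0 : R))).
  by rewrite /=; ring.
have last := @alpha_rec_last _ _ nu0 N (n - m.+1) m.
have en : n = (n - m.+1 + m.+1)%N by lia.
move: last; rewrite -en => /(_ mN) last.
have first := alpha_rec_first nu0 n mN.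
apply: (eq_linear_comb (p := D 0%N) (q := 1) (r := D m.+1) first mid last).
have -> : u 0%N = (m + n).+1%:R / ((m + n)%:R + nu) by rewrite /u muln0 subn0.
have -> : v m = ((n - m.+1)%:R + 2 * nu) / ((n - m.+1).+1%:R + nu).
  rewrite /v; have -> : (m + n - 2 * m = (n - m.+1).+1)%N by lia.
  by [].
by ring.
Qed.

End GegenbauerSum.

(** * Equality of the two families, entry by entry *)

Section WeightDecomposition.
Variables (R : realType) (nu x : R) (N : nat).
Hypothesis nu0 : 0 < nu.
Implicit Types (k m n t : nat).

Lemma LTLtC m n : LTLt nu x N m n = LTLt nu x N n m.
Proof. by apply: eq_bigr => k _; rewrite mulrAC -mulrA mulrC. Qed.

(** Row 0 of L is the first unit vector, so only k = 0 contributes. *)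
Lemma LTLt0 n : LTLt nu x N 0 n = gegenbauer_sum nu x N 0 n.
Proof.
rewrite /LTLt big_ord_recl big1 ?addr0 => [|k _]; last by rewrite L_entry_lt// !mul0r.
rewrite /gegenbauer_sum big_ord1 /= muln0 add0n subn0 L_entry_diag L_entry_col0//.
have nu_gt0 := nu0; have n0 : (0 : R) <= n%:R by [].
have p1 : poch (2 * nu) n != 0 by rewrite poch_neq0// mulr_gt0.
have p2 : poch nu n != 0 by rewrite poch_neq0.
rewrite /T_entry /t_coef /alpha !poch0 muln0 !(subn0, addn0, add0n) fact0 expr0.
have := fact_neq0 R N; have := fact_neq0 R n.
move: (n`!%:R : R) (N`!%:R : R) => f g f0 g0.
by field; nonzero.
Qed.

Lemma LTLt_gegenbauer_sum m n : (m <= n)%N -> (n <= N)%N ->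
  LTLt nu x N m n = gegenbauer_sum nu x N m n.
Proof.
elim/ltn_ind: m n => -[|m] IH n mn nN; first exact: LTLt0.
have mN : (m < N)%N by apply: leq_trans nN.
have Nm : N%:R - m%:R != 0 :> R by rewrite subr_eq0 eqr_nat gtn_eqF.
apply: (mulfI Nm).
have := LTLt_rec x nu0 (ltnW mN) nN.
have -> : LTLt nu x N m n = gegenbauer_sum nu x N m n by rewrite IH// ltnW.
(* Here m + 1 <= n keeps (m, n - 1) on or above the diagonal. *)
have -> : n%:R * LTLt nu x N m n.-1 = n%:R * gegenbauer_sum nu x N m n.-1.
  by rewrite IH//; lia.
have -> : m%:R * LTLt nu x N m.-1 n = m%:R * gegenbauer_sum nu x N m.-1 n.
  by case: m IH mn {mN Nm} => [|m] IH mn; rewrite ?mul0r// IH//=; lia.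
have -> : (N%:R - n%:R) * LTLt nu x N m n.+1 =
    (N%:R - n%:R) * gegenbauer_sum nu x N m n.+1.
  have [->|nN'] := eqVneq n N; first by rewrite subrr !mul0r.
  by rewrite IH//; lia.
by rewrite -gegenbauer_sum_rec// => /addIr.
Qed.

(** The Pochhammer symbol with base n - N contains a zero factor as soon as its length m - t exceeds
    N - n. *)
Lemma alpha_eq0 t m n : (m <= n)%N -> (n <= N)%N -> (t < n + m - N)%N ->
  alpha N nu t m n = 0.
Proof.
move=> mn nN tl; rewrite /alpha.
have -> : n%:R - N%:R = - (N - n)%:R :> R by rewrite natrB// opprB.
by rewrite poch_oppn ?mulr0 ?mul0r//; lia.
Qed.

Lemma weight_upperE m n : (m <= n)%N -> (n <= N)%N ->
  weight_upper N nu x m n = (1 - x ^+ 2) `^ (nu - 2^-1) * LTLt nu x N m n.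
Proof.
move=> mn nN; rewrite LTLt_gegenbauer_sum// /weight_upper; congr (_ * _).
rewrite /gegenbauer_sum -(big_mkord xpredT
  (fun t => alpha N nu t m n * gegenbauer nu (m + n - 2 * t) x)).
rewrite [RHS](@big_cat_nat _ _ _ (n + m - N))//=; last by lia.
suff -> : \sum_(0 <= t < n + m - N)
    alpha N nu t m n * gegenbauer nu (m + n - 2 * t) x = 0 by rewrite add0r.
by rewrite big_nat big1// => t tl; rewrite alpha_eq0// mul0r.
Qed.

Lemma weight_entryE m n : (m <= N)%N -> (n <= N)%N ->
  weight_entry N nu x m n = (1 - x ^+ 2) `^ (nu - 2^-1) * LTLt nu x N m n.
Proof.
move=> mN nN; rewrite /weight_entry; case: leqP => [mn|/ltnW nm].
  exact: weight_upperE.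
by rewrite weight_upperE// LTLtC.
Qed.

End WeightDecomposition.

(** * Polynomial form of L *)

Section LPolynomial.
Variable R : realType.
Implicit Types (l nu : R) (n m k : nat).

Definition gegenbauer_poly l n : {poly R} :=
  (poch (2 * l) n / n`!%:R) *:
  \sum_(j < n.+1) hyp_coef l n j *: (2^-1 *: (1 - 'X)) ^+ j.

Lemma horner_gegenbauer_poly l n x : (gegenbauer_poly l n).[x] = gegenbauer l n x.
Proof.
rewrite gegenbauerE hornerZ horner_sum; congr (_ * _).
by apply: eq_bigr => j _; rewrite !(hornerE, horner_exp).
Qed.

Definition L_poly nu m k : {poly R} :=
  if (m < k)%N then 0
  else (m`!%:R / (k`!%:R * poch (2 * nu + 2 * k%:R) (m - k)))
       *: gegenbauer_poly (nu + k%:R) (m - k).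

Lemma horner_L_poly nu m k x : (L_poly nu m k).[x] = L_entry nu x m k.
Proof.
rewrite /L_poly /L_entry; case: ifP => _; first by rewrite horner0.
by rewrite hornerZ horner_gegenbauer_poly.
Qed.

End LPolynomial.

(** * The matrix decomposition over the complex numbers *)

Local Open Scope complex_scope.

Lemma weight_LTLt (R : realType) (N : nat) (nu x : R) : 0 < nu -> -1 < x < 1 ->
  weight N nu x = Lmx N nu x *m Tmx N nu x *m (Lmx N nu x)^T.
Proof.
move=> nu0 /andP[x1 x2].
have w0 : 0 < 1 - x ^+ 2 by nra.
have LT m k : (Lmx N nu x *m Tmx N nu x) m k =
  (L_entry nu x m k * (t_coef N nu k * (1 - x ^+ 2) `^ (k%:R + nu - 2^-1)))%:C.
  rewrite mxE (bigD1 k)//= big1 ?addr0 => [|j jk].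
    by rewrite !mxE eqxx [RHS]rmorphM.
  by rewrite !mxE (negbTE jk) mulr0.
apply/matrixP => m n; rewrite !mxE weight_entryE// -1?ltnS//.
rewrite /LTLt mulr_sumr rmorph_sum; apply: eq_bigr => k _.
rewrite LT !mxE -rmorphM; congr (_%:C).
(* Splitting the exponent uses that the base is positive, that is |x| < 1. *)
have -> : (1 - x ^+ 2) `^ (k%:R + nu - 2^-1) =
    (1 - x ^+ 2) ^+ k * (1 - x ^+ 2) `^ (nu - 2^-1).
  rewrite -(powR_mulrn _ (ltW w0)) -powRD ?addrA//.
  by apply/implyP => _; exact/lt0r_neq0.
by rewrite /T_entry; ring.
Qed.

Local Close Scope complex_scope.

Theorem theorem2p2 (R : realType) (N : nat) (nu : R) (hnu : 0 < nu) :
  [/\ (forall x : R, -1 < x < 1 ->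
         weight N nu x = Lmx N nu x *m Tmx N nu x *m (Lmx N nu x)^T),
      (forall x : R, -1 <= x <= 1 -> unipotent_lower (Lmx N nu x)),
      polynomial_mx_on [set x : R | -1 <= x <= 1] (Lmx N nu)
    & (forall x : R, -1 < x < 1 -> is_diag_mx (Tmx N nu x))].
Proof.
split.
- by move=> x; exact: weight_LTLt.
- move=> x _; split.
    by apply/is_trig_mxP => i j ij; rewrite mxE L_entry_lt.
  by move=> i; rewrite mxE L_entry_diag.
(* The entries are real polynomials embedded coefficientwise; evaluation at a real point commutes
   with the embedding. *)
- exists (\matrix_(m, k) map_poly (real_complex R) (L_poly nu m k)) => x _.
  by apply/matrixP => m k; rewrite !mxE horner_map horner_L_poly.
- move=> x _; apply/is_diag_mxP => i j ij; rewrite mxE.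
  by rewrite -val_eqE (negbTE ij).
Qed.
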